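(* Let $f:\mathbb{Z}_+\to(0,1]$ be an arbitrary function. Then there exist a number $\gamma\in(0,1)$ and a function $g:\mathbb{Z}_+\to(0,1]$ with $0<g(x)<f(x)$ for all $x\in\mathbb{Z}_+$ such that for every real number $\alpha$ the following holds: if the inequality $$\left|\alpha-\frac{p}{q}\right|<\frac{\gamma\cdot f(q)}{q^2}$$ has infinitely many solutions in rationals $\frac{p}{q}$ (with $p\in\mathbb{Z}$, $q\in\mathbb{Z}_+$), then the stronger inequality $$\left|\alpha-\frac{p}{q}\right|<\frac{\gamma\cdot f(q)-g(q)}{q^2}$$ also has infinitely many solutions in rationals $\frac{p}{q}$.
   Context: $\mathbb{Z}_+$ denotes the set of positive integers. The function $g$ depends only on $f$ (not on $\alpha$). *)

(* Defs.v *)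
From mathcomp Require Import all_boot all_order all_algebra.
From mathcomp Require Import boolp classical_sets cardinality reals.

Set Implicit Arguments.
Unset Strict Implicit.
Unset Printing Implicit Defensive.

Import Order.TTheory GRing.Theory Num.Theory.

Local Open Scope classical_set_scope.
Local Open Scope ring_scope.

(* The rational numbers solving |alpha - p/q| < psi(q) / q^2.  The right-hand
   side depends on the representation p/q, which need not be in lowest terms;
   solutions are counted as elements of rat, so different representations of
   one rational number count once. *)
Definition rat_solutions (R : realType) (psi : nat -> R) (alpha : R) : set rat :=
  [set r : rat | exists (p : int) (q : nat),
    [/\ (0 < q)%N, r = p%:~R / q%:R
      & `|alpha - p%:~R / q%:R| < psi q / q%:R ^+ 2]].

(* Main.v *)
(* A counterexample alpha lies, for infinitely many p/q, in the thin layer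
   between the two intervals around p/q, hence within g(q)/q^2 of an endpoint
   p/q +- gamma f(q)/q^2.  By Baire's theorem gamma can be chosen so that every
   such endpoint is interior to the larger interval of some p'/q' with q' > q:
   for a single endpoint this is an open condition on gamma, and it is dense
   since moving gamma slightly makes the endpoint equal to p'/q'.  If g is small
   enough, the whole layer at p/q then lies in the smaller interval of p'/q'.
   Up to integer translation there are finitely many endpoints with given q, so
   g(n) only has to meet the finitely many constraints with q <= n. *)
Require Import Defs.
From mathcomp Require Import all_boot all_order all_algebra.
From mathcomp Require Import boolp classical_sets cardinality reals.
From mathcomp Require Import topology normedtype sequences.
From mathcomp Require Import ring lra zify.

Set Implicit Arguments.
Unset Strict Implicit.
Unset Printing Implicit Defensive.

Import Order.TTheory GRing.Theory Num.Theory.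
Import numFieldNormedType.Exports.

Local Open Scope classical_set_scope.
Local Open Scope ring_scope.

Lemma ratr_frac (F : numFieldType) (p : int) (q : nat) :
  ratr (p%:~R / q%:R) = p%:~R / q%:R :> F.
Proof. by rewrite fmorph_div /= ratr_int ratr_nat. Qed.

Lemma denq_frac_le (p : int) (q : nat) :
  (0 < q)%N -> denq (p%:~R / q%:R) <= q%:Z.
Proof.
move=> q0; have -> : p%:~R / q%:R = fracq (p, q%:Z) by rewrite fracqE.
by rewrite den_fracq /= -lt0n q0 lez_nat leq_div.
Qed.

Lemma dist_rat_ge (r s : rat) :
  r != s -> ((denq r)%:~R * (denq s)%:~R)^-1 <= `|r - s|.
Proof.
move=> rs; set n := numq r * denq s - numq s * denq r.
have dr0 : 0 < (denq r)%:~R :> rat by rewrite ltr0z denq_gt0.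
have ds0 : 0 < (denq s)%:~R :> rat by rewrite ltr0z denq_gt0.
have rsE : r - s = n%:~R / ((denq r)%:~R * (denq s)%:~R).
  rewrite -{1}(divq_num_den r) -{1}(divq_num_den s) rmorphB !rmorphM /=.
  by field; rewrite !gt_eqF.
have n_neq0 : n != 0.
  by apply: contraNneq rs => n0; rewrite -subr_eq0 rsE n0 mul0r.
rewrite rsE normf_div (gtr0_norm (mulr_gt0 dr0 ds0)).
apply: ler_peMl; first by rewrite invr_ge0 mulr_ge0 ?ltW.
by rewrite -intr_norm ler1z -gtz0_ge1 normr_gt0.
Qed.

Lemma exists_endpoint_dist_le (R : realDomainType) (x a c e : R) :
  `|x - a| < c -> c - e <= `|x - a| ->
  exists s : bool, `|x - (a + (-1) ^+ s * c)| <= e.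
Proof.
case: (ltP x a) => [xa|ax] xac cex; [exists true|exists false]; move: xac cex.
  by rewrite ltr0_norm ?subr_lt0 //= expr1 mulN1r ler_norml; lra.
by rewrite ger0_norm ?subr_ge0 //= expr0 mul1r ler_norml; lra.
Qed.

Lemma dense_countable_bigcap (K : realType) (U : completeNormedModType K)
    (T : countType) (F : T -> set U) :
  (forall t, open (F t)) -> (forall t, dense (F t)) -> dense (\bigcap_t F t).
Proof.
move=> oF dF.
pose G n := if unpickle n is Some t then F t else [set: U].
have dG : dense (\bigcap_n G n).
  apply: Baire => n; rewrite /G; case: (unpickle n) => [t|].
    by split; [exact: oF|exact: dF].
  by split; [exact: openT|move=> O [x Ox] _; exists x].
move=> O O0 oO; have [x [Ox Gx]] := dG O O0 oO.
by exists x; split=> // t _; have := Gx (pickle t) I; rewrite /G pickleK.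
Qed.

Lemma exists_gt0_lt_prefix (R : realFieldType) (e : nat -> R) :
  (forall n, 0 < e n) ->
  exists2 g : nat -> R, forall n, 0 < g n &
    forall m n, (m <= n)%N -> g n < e m.
Proof.
move=> e_gt0.
have /choice[g g_lt] n : exists y : R, 0 < y /\ forall m : 'I_n.+1, y < e m.
  near (0 : R)^'+ => y; exists y; split=> //.
  by near: y; apply: filter_forall => m; exact: nbhs_right_lt.
exists g => [n|m n mn]; first by case: (g_lt n).
by have [_ /(_ (Ordinal (mn : (m < n.+1)%N)))] := g_lt n.
Unshelve. all: by end_near. Qed.

Section RationalApproximation.
Variable R : realType.
Implicit Types (alpha c x : R) (psi rho : nat -> R) (N q : nat).

Definition approximable rho N : set R :=
  [set x | exists (p : int) (q : nat),
    (N < q)%N /\ `|x - p%:~R / q%:R| < rho q].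

Lemma finite_rat_denq_le alpha c (b : int) :
  finite_set [set r : rat | denq r <= b /\ `|alpha - ratr r| <= c].
Proof.
pose M := Num.truncn (b%:~R * (`|alpha| + c)).
pose fraction (x : nat * nat) : rat := (x.1%:Z - M%:Z)%:~R / x.2%:R.
have : finite_set (fraction @` (`I_(M + M).+1 `*` `I_`|b|.+1)).
  by apply: finite_image; apply: finite_setX; exact: finite_II.
apply: sub_finite_set => r [rb r_close].
have d0 := denq_gt0 r.
have numq_le : (`|numq r| <= M)%N.
  rewrite -ltnS -(ltr_nat R) natr_absz intr_norm.
  apply: le_lt_trans (truncnS_gt _).
  rewrite -(ratr_int R) numqE rmorphM /= ratr_int normrM mulrC.
  apply: ler_pM => //; first by rewrite gtr0_norm ?ltr0z // ler_int.
  by have := ler_normB alpha (alpha - ratr r); rewrite subKr; lra.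
exists (absz (numq r + M%:Z), absz (denq r)); first by split => /=; lia.
rewrite /fraction /= -[in RHS](divq_num_den r) natr_absz gtr0_norm //.
by congr (_%:~R / _); lia.
Qed.

Section BoundedNumerator.
Variables (psi : nat -> R) (c : R).
Hypothesis psi_le : forall q, (0 < q)%N -> psi q <= c.

Lemma rat_solutions_dist_lt alpha (r : rat) :
  rat_solutions psi alpha r -> `|alpha - ratr r| < c / (denq r)%:~R ^+ 2.
Proof.
move=> [p [q [q0 rE]]]; rewrite -ratr_frac -rE => r_close.
have q2 : 0 < q%:R ^+ 2 :> R by rewrite exprn_gt0 // ltr0n.
apply: (lt_le_trans r_close).
have psi_gt0 : 0 < psi q.
  by have := le_lt_trans (normr_ge0 _) r_close; rewrite pmulr_lgt0 ?invr_gt0.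
apply: ler_pM; [exact: ltW|by rewrite invr_ge0 ltW|exact: psi_le|].
rewrite lef_pV2 ?posrE ?exprn_gt0 ?ltr0n ?ltr0z ?denq_gt0 //.
rewrite ler_pXn2r ?nnegrE ?ler0z ?ler0n ?denq_ge0 //.
by rewrite [leRHS]pmulrn ler_int rE denq_frac_le.
Qed.

Lemma rat_solutions_dist_le alpha (r : rat) :
  rat_solutions psi alpha r -> `|alpha - ratr r| <= c.
Proof.
move=> /rat_solutions_dist_lt r_close.
have d1 : 1 <= (denq r)%:~R ^+ 2 :> R.
  by rewrite exprn_ege1 // ler1z -gtz0_ge1 denq_gt0.
have d0 := lt_le_trans ltr01 d1.
have c0 : 0 < c.
  by have := le_lt_trans (normr_ge0 _) r_close; rewrite pmulr_lgt0 ?invr_gt0.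
by apply: le_trans (ltW r_close) _; rewrite ler_pdivrMr // ler_peMr // ltW.
Qed.

Lemma infinite_rat_solutions_irrational alpha :
  infinite_set (rat_solutions psi alpha) -> irrational alpha.
Proof.
move=> inf [r _ rE]; apply: inf.
have fin := finite_rat_denq_le alpha c (Num.ceil (c * (denq r)%:~R)).
apply: sub_finite_set (_ : finite_set ([set r] `|` _)); last first.
  by rewrite finite_setU; split; [exact: finite_set1|exact: fin].
move=> s sol; have [->|sr] := eqVneq s r; [by left|right].
split; last exact: rat_solutions_dist_le.
rewrite -(ler_int R); apply: le_trans (ceil_ge _).
have dr0 : 0 < (denq r)%:~R :> R by rewrite ltr0z denq_gt0.
have ds0 : 0 < (denq s)%:~R :> R by rewrite ltr0z denq_gt0.
have := rat_solutions_dist_lt sol; rewrite -rE -rmorphB /= -ratr_norm.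
have : r != s by rewrite eq_sym.
move=> /dist_rat_ge; rewrite -(ler_rat R) fmorphV rmorphM /= !ratr_int.
move=> /le_lt_trans /[apply]; rewrite ltr_pdivlMr ?exprn_gt0 //.
have -> : ((denq r)%:~R * (denq s)%:~R)^-1 * (denq s)%:~R ^+ 2
    = (denq s)%:~R / (denq r)%:~R :> R by field; rewrite !gt_eqF.
by rewrite ltr_pdivrMr // => /ltW.
Qed.

Lemma infinite_rat_solutions_approximable alpha N :
  infinite_set (rat_solutions psi alpha) ->
  approximable (fun q => psi q / q%:R ^+ 2) N alpha.
Proof.
move=> inf; apply: contrapT => unapproximable; apply: inf.
apply: sub_finite_set (finite_rat_denq_le alpha c N%:Z) => r sol.
split; last exact: rat_solutions_dist_le.
case: sol => [p [q [q0 -> pq_close]]].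
apply: le_trans (denq_frac_le _ q0) _; rewrite lez_nat leqNgt.
by apply/negP => Nq; apply: unapproximable; exists p, q.
Qed.

Lemma approximable_infinite_rat_solutions alpha :
  irrational alpha ->
  (forall N, approximable (fun q => psi q / q%:R ^+ 2) N alpha) ->
  infinite_set (rat_solutions psi alpha).
Proof.
move=> irr approx fin.
have closed_solutions : closed (ratr @` rat_solutions psi alpha : set R).
  move/hausdorff_accessible: (@Rhausdorff R) => /accessible_finite_set_closed.
  by apply; exact: finite_image.
have /nbhs_ballP[e /= e0 far] :
    nbhs alpha (~` (ratr @` rat_solutions psi alpha)).
  apply: open_nbhs_nbhs; split; first by rewrite openC.
  by move=> [r _ rE]; apply: irr; exists r.
have [p [q [Nq pq_close]]] := approx (Num.truncn (c / e)).
have q0 : (0 < q)%N by lia.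
have sol : rat_solutions psi alpha (p%:~R / q%:R) by exists p, q.
apply: (far (p%:~R / q%:R)); last first.
  by exists (p%:~R / q%:R) => //; rewrite ratr_frac.
rewrite /ball /=; apply: lt_le_trans pq_close _.
have q1 : 1 <= q%:R :> R by rewrite ler1n.
have c_lt_eq : c < e * q%:R.
  rewrite mulrC -ltr_pdivrMr //.
  by apply: lt_le_trans (truncnS_gt _) _; rewrite ler_nat.
rewrite ler_pdivrMr ?exprn_gt0 ?ltr0n //; apply: le_trans (psi_le q0) _.
by apply: le_trans (ltW c_lt_eq) _; rewrite ler_pM2l // expr2 ler_peMr // ler0n.
Qed.

Lemma infinite_rat_solutionsP alpha :
  infinite_set (rat_solutions psi alpha) <->
  irrational alpha /\
    forall N, approximable (fun q => psi q / q%:R ^+ 2) N alpha.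
Proof.
split=> [inf|[]]; last exact: approximable_infinite_rat_solutions.
split=> [|N]; first exact: infinite_rat_solutions_irrational.
exact: infinite_rat_solutions_approximable.
Qed.

End BoundedNumerator.

Lemma le_approximable rho rho' N :
  (forall q, (N < q)%N -> rho q <= rho' q) ->
  approximable rho N `<=` approximable rho' N.
Proof.
move=> rho_le x [p [q [Nq x_close]]]; exists p, q; split=> //.
exact: lt_le_trans x_close (rho_le q Nq).
Qed.

Lemma approximable_addz rho N x (k : int) :
  approximable rho N x -> approximable rho N (x + k%:~R).
Proof.
move=> [p [q [Nq x_close]]]; exists (p + k * q%:Z), q; split=> //.
have q0 : q%:R != 0 :> R by rewrite pnatr_eq0; lia.
by rewrite rmorphD rmorphM /= -pmulrn mulrDl mulfK // opprD addrACA subrr addr0.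
Qed.

Lemma approximable_ratr rho N (r : rat) :
  (forall q, (N < q)%N -> 0 < rho q) -> approximable rho N (ratr r).
Proof.
move=> rho_gt0; have d0 := denq_gt0 r.
exists (numq r * N.+1%:Z), (`|denq r| * N.+1)%N.
have Nq : (N < `|denq r| * N.+1)%N by apply: leq_pmull; lia.
split=> //.
suff -> : ratr r = (numq r * N.+1%:Z)%:~R / (`|denq r| * N.+1)%:R :> R.
  by rewrite subrr normr0 rho_gt0.
rewrite /ratr natrM natr_absz (gtr0_norm d0) rmorphM /= -pmulrn.
by rewrite -mulf_div divff ?mulr1 ?pnatr_eq0.
Qed.

Lemma approximable_margin rho N x :
  approximable rho N x ->
  \forall e \near 0^'+, approximable (fun q => rho q - e) N x.
Proof.
move=> [p [q [Nq x_close]]]; near=> e; exists p, q; split=> //.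
by rewrite ltrBrDl -ltrBrDr; near: e; apply: nbhs_right_lt; rewrite subr_gt0.
Unshelve. all: by end_near. Qed.

Lemma open_approximable (T : topologicalType) (f : T -> R)
    (rho : nat -> T -> R) N :
  continuous f -> (forall q, continuous (rho q)) ->
  open [set t | approximable (rho ^~ t) N (f t)].
Proof.
move=> cf crho.
have -> : [set t | approximable (rho ^~ t) N (f t)] =
    \bigcup_(u in [set u : int * nat | (N < u.2)%N])
      (fun t => rho u.2 t - `|f t - u.1%:~R / u.2%:R|) @^-1` [set y | 0 < y].
  apply/seteqP; split=> t /=.
    by move=> [p [q [Nq t_close]]]; exists (p, q) => //=; rewrite subr_gt0.
  by move=> [[p q] /= Nq]; rewrite subr_gt0 => t_close; exists p, q.
apply: bigcup_open => u _; apply: open_comp; last exact: open_gt.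
move=> t _; apply: cvgB; first exact: crho.
by apply: cvg_norm; apply: cvgB; [exact: cf|exact: cvg_cst].
Qed.

(* The radius is `|x| * psi q, not x * psi q, so that the set is dense on the
   whole line and not only among the positive reals. *)
Lemma dense_approximable_affine psi a w N :
  w != 0 -> (forall q, (N < q)%N -> 0 < psi q) ->
  dense [set x : R | approximable (fun q => `|x| * psi q) N (a + x * w)].
Proof.
move=> w0 psi_gt0 O O0 oO.
have [x [Ox /eqP x0]] := dense_set1C 0 O0 oO.
pose U := (fun y => (y - a) / w) @^-1` (O `&` ~` [set 0]).
have U0 : U !=set0.
  exists (a + x * w); rewrite /U /= addrAC subrr add0r mulfK //.
  by split=> //; exact/eqP.
have oU : open U.
  apply: open_comp; last by apply: openI => //; rewrite openC; exact: closed_eq.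
  move=> y _; apply: cvgM; last exact: cvg_cst.
  by apply: cvgB; [exact: cvg_id|exact: cvg_cst].
have [_ [/[swap] -[r _ <-] [Or /eqP r0]]] := dense_rat U0 oU.
exists ((ratr r - a) / w); split=> //=.
rewrite divfK // subrKC; apply: approximable_ratr => q Nq.
by rewrite mulr_gt0 ?normr_gt0 ?psi_gt0.
Qed.

Definition endpoint rho (p : int) q (s : bool) : R :=
  p%:~R / q%:R + (-1) ^+ s * rho q.

Definition endpoints_covered rho : Prop :=
  forall p q s, (0 < q)%N -> approximable rho q (endpoint rho p q s).

Lemma exists_scaling_endpoints_covered psi a b :
  (forall q, (0 < q)%N -> 0 < psi q) -> 0 <= a -> a < b ->
  exists2 gamma : R, a < gamma < b & endpoints_covered (fun q => gamma * psi q).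
Proof.
move=> psi_gt0 a0 ab.
pose F (t : int * nat * bool) : set R := let: (p, n, s) := t in
  [set x | approximable (fun q => `|x| * psi q) n.+1
             (p%:~R / n.+1%:R + x * ((-1) ^+ s * psi n.+1))].
have oF t : open (F t).
  case: t => [[p n] s].
  apply: (@open_approximable _
    (fun x : R => p%:~R / n.+1%:R + x * ((-1) ^+ s * psi n.+1))
    (fun q x => `|x| * psi q)) => [x|q x].
    apply: cvgD; first exact: cvg_cst.
    by apply: cvgM; [exact: cvg_id|exact: cvg_cst].
  by apply: cvgM; [apply: cvg_norm; exact: cvg_id|exact: cvg_cst].
have dF t : dense (F t).
  case: t => [[p n] s]; apply: dense_approximable_affine.
    by rewrite mulf_neq0 ?signr_eq0 // gt_eqF // psi_gt0.
  by move=> q nq; apply: psi_gt0; lia.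
have ab_neq0 : `]a, b[%classic !=set0.
  by exists ((a + b) / 2); rewrite /= mid_in_itv.
have [gamma [/=]] := dense_countable_bigcap oF dF ab_neq0 (itv_open a b).
rewrite in_itv /= => gab covered; exists gamma => // p [//|n] s _.
have := covered (p, n, s) I; rewrite /F /= gtr0_norm; last lra.
by rewrite /endpoint mulrCA.
Qed.

Lemma endpoints_covered_margin rho q :
  endpoints_covered rho -> (0 < q)%N ->
  \forall e \near 0^'+, forall p s,
    approximable (fun q' => rho q' - e) q (endpoint rho p q s).
Proof.
move=> covered q0.
have : \forall e \near 0^'+, forall t : 'I_q * bool,
    approximable (fun q' => rho q' - e) q (endpoint rho t.1%:Z q t.2).
  by apply: filter_forall => t; apply: approximable_margin; exact: covered.
apply: filterS => e fundamental p s.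
have r_ge0 : 0 <= (p %% q)%Z by rewrite modz_ge0; lia.
have r_lt : (`|(p %% q)%Z|%N < q)%N by have := @ltz_pmod p q q0; lia.
have -> : endpoint rho p q s =
    endpoint rho `|(p %% q)%Z|%N q s + (p %/ q)%Z%:~R.
  have q_neq0 : q%:R != 0 :> R by rewrite pnatr_eq0; lia.
  rewrite /endpoint gez0_abs // {1}(divz_eq p q) rmorphD rmorphM /= -pmulrn.
  by rewrite mulrDl mulfK // -addrA addrC.
apply: approximable_addz.
exact: (fundamental (Ordinal r_lt, s)).
Qed.

Lemma endpoints_covered_shrink rho h :
  endpoints_covered rho -> (forall q, (0 < q)%N -> 0 < h q) ->
  exists2 g : nat -> R, forall q, (0 < q)%N -> 0 < g q < h q &
    forall N, approximable rho N `<=` approximable (fun q => rho q - g q) N.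
Proof.
move=> covered h_gt0.
have /choice[e e_margin] q : exists y : R, 0 < y /\ ((0 < q)%N -> y < h q /\
    forall p s, approximable (fun q' => rho q' - y) q (endpoint rho p q s)).
  case: (posnP q) => [->|q0]; first by exists 1.
  near (0 : R)^'+ => y; exists y; split=> // _; split.
    by near: y; apply: nbhs_right_lt; exact: h_gt0.
  by near: y; exact: endpoints_covered_margin.
have e_gt0 q : 0 < e q by case: (e_margin q).
have [g g_gt0 g_small] :=
  exists_gt0_lt_prefix (fun q => divr_gt0 (e_gt0 q) (ltr0n R 2)).
exists g => [q q0|N x [p [q [Nq xq]]]].
  have [e_lt_h _] := (e_margin q).2 q0.
  by have := g_small _ _ (leqnn q); have := e_gt0 q; rewrite g_gt0 /=; lra.
have [xg|gx] := ltP `|x - p%:~R / q%:R| (rho q - g q); first by exists p, q.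
have [s] := exists_endpoint_dist_le xq gx.
rewrite -/(endpoint rho p q s) => xs.
have q0 : (0 < q)%N by lia.
have [_ /(_ p s)[p' [q' [qq' endpoint_q']]]] := (e_margin q).2 q0.
have gq := g_small _ _ (leqnn q); have gq' := g_small _ _ (ltnW qq').
exists p', q'; split; first exact: ltn_trans qq'.
have := ler_distD (endpoint rho p q s) x (p'%:~R / q'%:R).
by lra.
Unshelve. all: by end_near. Qed.

End RationalApproximation.

Theorem theorem1 (R : realType) (f : nat -> R)
    (hf : forall q : nat, (0 < q)%N -> 0 < f q <= 1) :
  exists (gamma : R) (g : nat -> R),
    [/\ 0 < gamma < 1,
        (forall q : nat, (0 < q)%N -> 0 < g q <= 1),
        (forall q : nat, (0 < q)%N -> 0 < g q < f q)
      & forall alpha : R,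
          infinite_set (rat_solutions (fun q => gamma * f q) alpha) ->
          infinite_set (rat_solutions (fun q => gamma * f q - g q) alpha)].
Proof.
have q2_gt0 q : (0 < q)%N -> 0 < q%:R ^+ 2 :> R.
  by move=> q0; rewrite exprn_gt0 ?ltr0n.
have psi_gt0 q : (0 < q)%N -> 0 < f q / q%:R ^+ 2.
  by move=> q0; rewrite divr_gt0 ?q2_gt0 //; case/andP: (hf q q0).
have [gamma gamma01 covered] :=
  exists_scaling_endpoints_covered psi_gt0 (lexx 0) ltr01.
have [g g_small shrink] := endpoints_covered_shrink covered psi_gt0.
have g_lt_f q : (0 < q)%N -> 0 < g q * q%:R ^+ 2 < f q.
  move=> q0; have /andP[g0 gpsi] := g_small q q0.
  by rewrite mulr_gt0 ?q2_gt0 //= -ltr_pdivlMr ?q2_gt0.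
have gammaf_le1 q : (0 < q)%N -> gamma * f q <= 1.
  by move=> /hf f01; nra.
exists gamma, (fun q => g q * q%:R ^+ 2); split=> // [q q0|alpha].
  by have := g_lt_f q q0; have := hf q q0; lra.
move=> /(infinite_rat_solutionsP (psi := fun q => gamma * f q) gammaf_le1).
move=> [irr approx]; apply/(@infinite_rat_solutionsP _ _ 1) => [q q0|].
  by have := gammaf_le1 q q0; have := g_lt_f q q0; lra.
split=> // N; apply: le_approximable (shrink N alpha _) => [q Nq|].
  by rewrite mulrBl mulfK ?gt_eqF ?q2_gt0 ?mulrA //; lia.
by apply: le_approximable (approx N) => q _; rewrite mulrA.
Qed.
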